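(* Let $n$ be a positive integer, let $r>1$ be an integer, and let $X=\mathbb{Z}_p[t,t^{-1}]/(\xi_m(t))$, regarded as an Alexander quandle, where $\xi_m(t)=\sum_{i=0}^{m-1}(-t)^i$. Suppose that either (i) $p=2$ and $m=2^n+1$, or (ii) $p$ is an odd prime and $m=(p^n+1)/2$. Then the $(2r+1)$-dimensional quandle cohomology group of $X$ with coefficients in (the additive group of) $X$ is non-trivial: $H^{2r+1}_{\rm Q}(X;X)\neq 0$.
   Context: $\mathbb{Z}_p=\mathbb{Z}/p\mathbb{Z}$. A quandle is a set $X$ with a binary operation $*$ such that $a*a=a$; for all $a,b$ there is a unique $c$ with $a=c*b$; and $(a*b)*c=(a*c)*(b*c)$. Any $\mathbb{Z}[t,t^{-1}]$-module $M$ is a quandle (Alexander quandle) under $a*b=ta+(1-t)b$. Quandle cohomology: for a quandle $X$ let $C_n^R(X)$ be the free abelian group on $X^n$, with boundary $$\partial_n(x_1,\ldots,x_n)=\sum_{i=2}^n(-1)^i\big[(x_1,\ldots,x_{i-1},x_{i+1},\ldots,x_n)-(x_1*x_i,\ldots,x_{i-1}*x_i,x_{i+1},\ldots,x_n)\big]$$ for $n\ge 2$ and $\partial_n=0$ for $n\le 1$. Let $C_n^D(X)\subset C_n^R(X)$ be the subgroup generated by tuples with $x_i=x_{i+1}$ for some $i\in\{1,\ldots,n-1\}$ if $n\geq 2$, and $C_n^D(X)=0$ otherwise; it is a subcomplex. Set $C_n^Q(X)=C_n^R(X)/C_n^D(X)$ with the induced boundary. For an abelian group $A$, $C_Q^n(X;A)=\mathrm{Hom}(C_n^Q(X),A)$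 with coboundary $\delta f=f\circ\partial$, and $H^n_{\rm Q}(X;A)$ is the $n$-th cohomology group of this cochain complex. *)

(* Defs.v *)
From HB Require Import structures.
From mathcomp Require Import all_boot all_order all_algebra.
From mathcomp Require Import generic_quotient ring_quotient.
From mathcomp Require Import boolp functions.
From mathcomp Require Import freeg zify.

Set Implicit Arguments.
Unset Strict Implicit.
Unset Printing Implicit Defensive.

Import GRing.Theory.

Local Open Scope ring_scope.
Local Open Scope quotient_scope.

Declare Scope quandle_scope.
Delimit Scope quandle_scope with qdl.

(* -------------------------------------------------------------------- *)
(* The right translation by [b] is a bijection: every [a] is [c * b] for
   exactly one [c].  Quandles are taken over a [choiceType] so that [freeg]
   applies to tuples of their elements. *)
HB.mixin Record isQuandle X of Choice X := {
  qop : X -> X -> X;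
  qopxx : forall a : X, qop a a = a;
  qop_div : forall a b : X, exists! c, a = qop c b;
  qop_distr : forall a b c : X, qop (qop a b) c = qop (qop a c) (qop b c)
}.

#[short(type="quandleType")]
HB.structure Definition Quandle := { X of Choice X & isQuandle X }.

Notation "a * b" := (qop a b) : quandle_scope.

(* -------------------------------------------------------------------- *)
(* R[t, t^-1], as the subring of the fractions p / t^k in Frac(R[t]). *)
Section Laurent.
Variable R : idomainType.

Definition laurent_pred : {pred {fraction {poly R}}} :=
  fun f => `[< exists (p : {poly R}) (k : nat),
               f = FracField.tofrac p / FracField.tofrac 'X ^+ k >].

Fact tofracX_neq0 : FracField.tofrac 'X != 0 :> {fraction {poly R}}.
Proof. by rewrite tofrac_eq0 polyX_eq0. Qed.

Fact laurent_pred_subring : subring_closed laurent_pred.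
Proof.
split=> [|f g|f g].
- by apply/asboolP; exists 1, 0; rewrite expr0 divr1 rmorph1.
- move=> /asboolP[p [k ->]] /asboolP[q [l ->]].
  apply/asboolP; exists (p * 'X ^+ l - q * 'X ^+ k), (k + l)%N.
  rewrite rmorphB !rmorphM !rmorphXn /= exprD invfM mulrBl; congr (_ - _).
    by rewrite mulrACA mulfV ?mulr1 // expf_neq0 // tofracX_neq0.
  by rewrite -mulrA mulVKf // expf_neq0 // tofracX_neq0.
- move=> /asboolP[p [k ->]] /asboolP[q [l ->]].
  apply/asboolP; exists (p * q), (k + l)%N.
  by rewrite rmorphM exprD invfM mulrACA.
Qed.

HB.instance Definition _ :=
  GRing.isSubringClosed.Build {fraction {poly R}} laurent_pred
    laurent_pred_subring.

Record laurent := Laurent {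
  laurent_val :> {fraction {poly R}};
  _ : laurent_val \in laurent_pred
}.

HB.instance Definition _ := [isSub for laurent_val].
HB.instance Definition _ := [Choice of laurent by <:].
HB.instance Definition _ := [SubChoice_isSubComNzRing of laurent by <:].

Fact laurentT_subproof : FracField.tofrac 'X \in laurent_pred.
Proof. by apply/asboolP; exists 'X, 0; rewrite expr0 divr1. Qed.

Definition laurentT : laurent := Laurent laurentT_subproof.

Fact laurentTV_subproof : (FracField.tofrac 'X)^-1 \in laurent_pred.
Proof. by apply/asboolP; exists 1, 1; rewrite expr1 rmorph1 mul1r. Qed.

Definition laurentTV : laurent := Laurent laurentTV_subproof.

Lemma laurentTK : laurentT * laurentTV = 1.
Proof. by apply: val_inj; rewrite rmorphM /= mulfV ?tofracX_neq0. Qed.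

End Laurent.

(* -------------------------------------------------------------------- *)
(* A / (a), as an A-module. *)
Section PrincipalQuotient.
Variables (A : comNzRingType) (a : A).

Definition principal_ideal : {pred A} := fun x => `[< exists c, x = c * a >].

Fact principal_ideal_zmod : zmod_closed principal_ideal.
Proof.
split=> [|x y]; first by apply/asboolP; exists 0; rewrite mul0r.
move=> /asboolP[c ->] /asboolP[d ->].
by apply/asboolP; exists (c - d); rewrite mulrBl.
Qed.

HB.instance Definition _ :=
  GRing.isZmodClosed.Build A principal_ideal principal_ideal_zmod.

Definition quot_by := {ideal_quot principal_ideal}.

HB.instance Definition _ := GRing.Zmodule.on quot_by.

Definition quot_by_proj : A -> quot_by := \pi_{ideal_quot principal_ideal}.

Lemma quot_by_projB : {morph quot_by_proj : x y / x - y}.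
Proof. by move=> x y; apply: (raddfB (\pi_{ideal_quot principal_ideal})). Qed.

Lemma quot_by_projD : {morph quot_by_proj : x y / x + y}.
Proof. by move=> x y; apply: (raddfD (\pi_{ideal_quot principal_ideal})). Qed.

Lemma quot_by_projK : cancel (fun q : quot_by => repr q) quot_by_proj.
Proof. exact: reprK. Qed.

Lemma quot_by_proj_eq x y :
  (quot_by_proj x == quot_by_proj y) = (x - y \in principal_ideal).
Proof. by rewrite Quotient.idealrBE. Qed.

Definition quot_by_scale (c : A) (q : quot_by) : quot_by :=
  quot_by_proj (c * repr q).

Lemma quot_by_scale_proj c x :
  quot_by_scale c (quot_by_proj x) = quot_by_proj (c * x).
Proof.
apply/eqP; rewrite quot_by_proj_eq -mulrBr.
have /eqP := quot_by_projK (quot_by_proj x).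
rewrite quot_by_proj_eq => /asboolP[d ->].
by apply/asboolP; exists (c * d); rewrite mulrA.
Qed.

Fact quot_by_scaleA c d q :
  quot_by_scale c (quot_by_scale d q) = quot_by_scale (c * d) q.
Proof. by rewrite -(quot_by_projK q) !quot_by_scale_proj mulrA. Qed.

Fact quot_by_scale1 : left_id 1 quot_by_scale.
Proof. by move=> q; rewrite -(quot_by_projK q) quot_by_scale_proj mul1r. Qed.

Fact quot_by_scaleDr : right_distributive quot_by_scale +%R.
Proof.
move=> c q1 q2; rewrite -(quot_by_projK q1) -(quot_by_projK q2).
by rewrite -quot_by_projD !quot_by_scale_proj mulrDr quot_by_projD.
Qed.

Fact quot_by_scaleDl q : {morph quot_by_scale^~ q : c d / c + d}.
Proof.
move=> c d; rewrite -(quot_by_projK q).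
by rewrite !quot_by_scale_proj mulrDl quot_by_projD.
Qed.

HB.instance Definition _ :=
  GRing.Zmodule_isLmodule.Build A quot_by
    quot_by_scaleA quot_by_scale1 quot_by_scaleDr quot_by_scaleDl.

End PrincipalQuotient.

(* -------------------------------------------------------------------- *)
(* The Alexander quandle of a module over R[t, t^-1].  For R = int this is the
   usual notion; for general R the operation only depends on the underlying
   Z[t, t^-1]-module. *)
Definition alexander (R : idomainType) (M : lmodType (laurent R)) : Type := M.

Section Alexander.
Variables (R : idomainType) (M : lmodType (laurent R)).

HB.instance Definition _ := Choice.on (alexander M).

Definition alexander_op (a b : alexander M) : alexander M :=
  laurentT R *: (a : M) + (1 - laurentT R) *: (b : M).

Fact alexander_opxx a : alexander_op a a = a.
Proof. by rewrite /alexander_op -scalerDl addrC subrK scale1r. Qed.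

Fact alexander_op_div a b : exists! c, a = alexander_op c b.
Proof.
exists (laurentTV R *: ((a : M) - (1 - laurentT R) *: (b : M))); split.
  by rewrite /alexander_op scalerA laurentTK scale1r subrK.
move=> c ->.
by rewrite /alexander_op addrK scalerA mulrC laurentTK scale1r.
Qed.

Fact alexander_op_distr a b c :
  alexander_op (alexander_op a b) c =
  alexander_op (alexander_op a c) (alexander_op b c).
Proof.
rewrite /alexander_op; set t := laurentT R.
rewrite !scalerDr !scalerA -!addrA; congr (_ + _).
rewrite [in RHS]addrCA [t * (1 - t)]mulrC; congr (_ + _).
by rewrite -scalerDl -mulrDr [t + _]addrC subrK mulr1.
Qed.

HB.instance Definition _ :=
  isQuandle.Build (alexander M)
    alexander_opxx alexander_op_div alexander_op_distr.

End Alexander.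

(* -------------------------------------------------------------------- *)
Section Chains.
Variable X : quandleType.

Definition chainR (n : nat) := {freeg (n.-tuple X) / int}.

HB.instance Definition _ n := GRing.Zmodule.on (chainR n).
HB.instance Definition _ n := GRing.Lmodule.on (chainR n).

(* [fintype.lift i] enumerates the indices other than [i]. *)
Definition face_del n (i : 'I_n.+1) (x : n.+1.-tuple X) : n.-tuple X :=
  [tuple tnth x (fintype.lift i j) | j < n].

Definition face_act n (i : 'I_n.+1) (x : n.+1.-tuple X) : n.-tuple X :=
  [tuple if (j < i)%N then (tnth x (fintype.lift i j) * tnth x i)%qdl
         else tnth x (fintype.lift i j) | j < n].

(* The sum over 2 <= i <= n+1 of the 1-based convention is the sum over
   0 < i here, whence the sign (-1)^(i+1). *)
Definition boundary_gen n (x : n.+1.-tuple X) : chainR n :=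
  \sum_(i < n.+1 | (0 < i)%N)
     (-1) ^+ i.+1 *: (<< face_del i x >> - << face_act i x >> : chainR n).

(* [boundaryR n : chainR n -> chainR n.-1]; in degree 0 the target is
   irrelevant since the map is zero, and in degree 1 the sum is empty. *)
Definition boundaryR (n : nat) : chainR n -> chainR n.-1 :=
  match n with
  | 0 => fun=> 0
  | n'.+1 => fglift (@boundary_gen n')
  end.

Fact boundaryR_additive n : zmod_morphism (@boundaryR n).
Proof.
case: n => [|n] x y /=; first by rewrite subrr.
exact: lift_is_additive.
Qed.

HB.instance Definition _ n :=
  GRing.isZmodMorphism.Build (chainR n) (chainR n.-1) (@boundaryR n)
    (@boundaryR_additive n).

Definition degenerate n (x : n.-tuple X) : Prop :=
  exists i j : 'I_n, j = i.+1 :> nat /\ tnth x i = tnth x j.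

(* The subgroup generated by the degenerate tuples. *)
Definition chainD n : {pred chainR n} :=
  fun c => `[< exists2 s : seq (int * n.-tuple X),
               (forall z, z \in s -> degenerate z.2)
               & c = \sum_(z <- s) << z.1 *g z.2 >> >].

Fact chainD_zmod n : zmod_closed (@chainD n).
Proof.
split=> [|c d]; first by apply/asboolP; exists [::]; rewrite ?big_nil.
move=> /asboolP[s ds ->] /asboolP[u du ->].
apply/asboolP; exists (s ++ [seq (- z.1, z.2) | z <- u]).
  move=> z; rewrite mem_cat => /orP[/ds//|/mapP[w wu ->]]; exact: du wu.
rewrite big_cat big_map -sumrN /=; congr (_ + _).
by apply: eq_bigr => z _; rewrite freegUN.
Qed.

HB.instance Definition _ n :=
  GRing.isZmodClosed.Build (chainR n) (@chainD n) (@chainD_zmod n).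

Lemma chainDU n k (x : n.-tuple X) :
  degenerate x -> << k *g x >> \in @chainD n.
Proof.
move=> dx; apply/asboolP; exists [:: (k, x)]; last by rewrite big_seq1.
by move=> z; rewrite inE => /eqP ->.
Qed.

Lemma chainDZ n (k : int) (c : chainR n) :
  c \in @chainD n -> k *: c \in @chainD n.
Proof. by move=> ?; rewrite -[k]intz scaler_int rpredMz. Qed.

Lemma face_act0 n (x : n.+1.-tuple X) : face_act ord0 x = face_del ord0 x.
Proof. by apply: eq_from_tnth => j; rewrite !tnth_mktuple. Qed.

Lemma boundary_genE n (x : n.+1.-tuple X) :
  boundary_gen x =
  \sum_(i < n.+1)
     (-1) ^+ i.+1 *: (<< face_del i x >> - << face_act i x >> : chainR n).
Proof.
rewrite /boundary_gen [RHS]big_mkcond [LHS]big_mkcond /=.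
apply: eq_bigr => i _; case: posnP => // i0.
have -> : i = ord0 :> 'I_n.+1 by apply: val_inj.
by rewrite face_act0 subrr scaler0.
Qed.

Section BoundarySquare.
Variable n : nat.

Local Notation pairT := ('I_n.+2 * 'I_n.+1)%type.

Let swap (p : pairT) : pairT :=
  if (p.2 < p.1)%N then (inord p.2, inord p.1.-1) else (inord p.2.+1, inord p.1).

Let swapE (p : pairT) :
  (swap p).1 = (if (p.2 < p.1)%N then p.2 : nat else p.2.+1) :> nat /\
  (swap p).2 = (if (p.2 < p.1)%N then p.1.-1 else p.1) :> nat.
Proof.
have h1 := ltn_ord p.1; have h2 := ltn_ord p.2.
by rewrite /swap; case: ltnP => ? /=; rewrite !inordK //; lia.
Qed.

Let swapK : involutive swap.
Proof.
move=> p; have [e1 e2] := swapE p; have [f1 f2] := swapE (swap p).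
rewrite [LHS]surjective_pairing [RHS]surjective_pairing.
congr (_, _); apply: val_inj; rewrite /= ?f1 ?f2 e1 e2;
  by case: (ltnP p.2 p.1) => ?; case: ltnP; lia.
Qed.

Let swapP p : ~~ ((swap p).2 < (swap p).1)%N = (p.2 < p.1)%N.
Proof.
have [-> ->] := swapE p; move: (nat_of_ord p.1) (nat_of_ord p.2) => u v.
by case: (ltnP v u) => ?; case: ltnP => //; lia.
Qed.

Let face (b : bool) m := if b then @face_act m else @face_del m.

Let face_comm b c (x : n.+2.-tuple X) (k k' : 'I_n.+2) (l l' : 'I_n.+1) :
  (l < k)%N -> k' = l :> nat -> l' = k.-1 :> nat ->
  face b l (face c k x) = face c l' (face b k' x).
Proof.
move=> lk k'E l'E; apply: eq_from_tnth => j.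
have E1 : fintype.lift k (fintype.lift l j) =
          fintype.lift k' (fintype.lift l' j).
  by apply: val_inj; rewrite /= /bump k'E l'E; lia.
have E2 : fintype.lift k l = k' by apply: val_inj; rewrite /= /bump k'E; lia.
have E3 : fintype.lift k' l' = k.
  by apply: val_inj; rewrite /= /bump k'E l'E; lia.
have B1 : (fintype.lift l j < k)%N = (j < l')%N by rewrite /= /bump; lia.
have B2 : (fintype.lift l' j < k')%N = (j < l)%N by rewrite /= /bump; lia.
have Bl : (l < k)%N by [].
have Bl' : (l' < k')%N = false by lia.
have Bj : (j < l)%N -> (j < l')%N by lia.
case: b c => [] []; rewrite /face !tnth_mktuple ?E1 ?E2 ?E3 ?B1 ?B2 ?Bl ?Bl' //.
by have [jl|//] := boolP (j < l)%N; rewrite (Bj jl) -qop_distr.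
Qed.

Lemma boundary_gen_comp (x : n.+2.-tuple X) :
  fglift (@boundary_gen n) (boundary_gen x) = 0.
Proof.
pose F (p : pairT) : chainR n := (-1) ^+ (p.1 + p.2) *:
  \sum_(c : bool) \sum_(b : bool)
    (-1) ^+ (c + b) *: << face b p.2 (face c p.1 x) >>.
have -> : fglift (@boundary_gen n) (boundary_gen x) = \sum_p F p.
  rewrite boundary_genE -[fglift _]/(@boundaryR n.+1).
  rewrite (raddf_sum (@boundaryR n.+1)) -(pair_bigA _ (fun k l => F (k, l))).
  apply: eq_bigr => k _; rewrite raddfZsign raddfB /= !liftU !scale1r.
  rewrite !boundary_genE -sumrB scaler_sumr; apply: eq_bigr => l _.
  rewrite -scalerBr scalerA /F !big_bool /= -exprD addSn addnS !exprS !mulN1r.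
  rewrite !opprK ?expr0 ?scale1r !scaleN1r opprB; congr (_ *: _).
  by rewrite addrC; congr (_ + _); rewrite addrC.
rewrite (bigID (fun p : pairT => (p.2 < p.1)%N)) /=.
rewrite -[RHS](subrr (\sum_(p : pairT | (p.2 < p.1)%N) F p)).
congr (_ + _); rewrite (reindex_inj (inv_inj swapK)) -sumrN.
apply: eq_big => [p|p]; rewrite swapP // => lp.
have [s1 s2] := swapE p; rewrite lp in s1 s2.
have e : (p.1 + p.2 = ((swap p).1 + (swap p).2).+1)%N.
  by rewrite s1 s2; move: (nat_of_ord p.1) (nat_of_ord p.2) lp => u v; lia.
rewrite /F e exprS mulN1r scaleNr opprK exchange_big; congr (_ *: _).
apply: eq_bigr => b _; apply: eq_bigr => c _.
by rewrite addnC (face_comm c b x lp s1 s2).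
Qed.

End BoundarySquare.

Lemma boundaryR_comp n (c : chainR n) : boundaryR (boundaryR c) = 0.
Proof.
case: n c => [|[|n]] c; [by [] | by [] |].
have bU (k : int) (x : n.+2.-tuple X) :
  @boundaryR n.+2 << k *g x >> = k *: boundary_gen x by exact: liftU.
rewrite -[c]freeg_sumE !raddf_sum; apply: big1 => x _.
transitivity (boundaryR (@boundaryR n.+2 << coeff x c *g x >>)); first by [].
rewrite bU -[coeff x c]intz scaler_int raddfMz.
transitivity ((0 : chainR n) *~ coeff x c); last exact: mul0rz.
by congr (_ *~ _); exact: boundary_gen_comp.
Qed.

Section DegenerateFaces.
Variables (n : nat) (x : n.+1.-tuple X) (a b : 'I_n.+1).
Hypotheses (ab : b = a.+1 :> nat) (xab : tnth x a = tnth x b).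

Lemma face_del_eq : face_del a x = face_del b x.
Proof.
apply: eq_from_tnth => j; rewrite !tnth_mktuple.
have [ja|aj|ja] := ltngtP j a.
- congr (tnth x _); apply: val_inj; rewrite /= /bump ab; lia.
- congr (tnth x _); apply: val_inj; rewrite /= /bump ab; lia.
- have -> : fintype.lift a j = b by apply: val_inj; rewrite /= /bump ab; lia.
  by rewrite -xab; congr (tnth x _); apply: val_inj; rewrite /= /bump ab; lia.
Qed.

Lemma face_act_eq : face_act a x = face_act b x.
Proof.
apply: eq_from_tnth => j.
have := congr1 (fun y => tnth y j) face_del_eq; rewrite !tnth_mktuple => <-.
have [ja|aj|ja] := ltngtP j a.
- by rewrite xab (_ : (j < b)%N) //; lia.
- by rewrite (_ : (j < b)%N = false) //; lia.
- rewrite (_ : (j < b)%N); last by lia.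
  have -> : fintype.lift a j = b by apply: val_inj; rewrite /= /bump ab; lia.
  by rewrite qopxx.
Qed.

Lemma face_degenerate i : i != a -> i != b ->
  degenerate (face_del i x) /\ degenerate (face_act i x).
Proof.
rewrite -!val_eqE /= ab => ia ib.
have hn := ltn_ord i; have hb := ltn_ord b; rewrite ab in hb.
pose c := (a - (i < a))%N.
have hc : (c < n)%N by rewrite /c; lia.
have hd : (c.+1 < n)%N by rewrite /c; lia.
have Ec : fintype.lift i (Ordinal hc) = a.
  by apply: val_inj; rewrite /= /bump /c; lia.
have Ed : fintype.lift i (Ordinal hd) = b.
  by apply: val_inj; rewrite /= /bump /c ab; lia.
split; exists (Ordinal hc), (Ordinal hd); split; rewrite // !tnth_mktuple Ec Ed //.
have -> : (Ordinal hc < i)%N = (Ordinal hd < i)%N by rewrite /= /c; lia.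
by rewrite xab.
Qed.

End DegenerateFaces.

Lemma boundary_gen_degenerate n (x : n.+1.-tuple X) :
  degenerate x -> boundary_gen x \in @chainD n.
Proof.
move=> [a [b [ab xab]]]; rewrite boundary_genE.
have ba : b != a by rewrite -val_eqE /= ab; lia.
rewrite (bigD1 a) //= (bigD1 b) //= addrA rpredD //.
  rewrite (face_del_eq ab xab) (face_act_eq ab xab) -scalerDl ab.
  by rewrite [in X in _ + X]exprS mulN1r subrr scale0r rpred0.
rewrite rpred_sum // => i /andP[ia ib].
have [di ai] := face_degenerate ab xab ia ib.
by rewrite chainDZ // rpredB ?chainDU.
Qed.

Lemma boundaryR_chainD n (c : chainR n) :
  c \in @chainD n -> boundaryR c \in @chainD n.-1.
Proof.
case: n c => [|n] c; first by rewrite /= rpred0.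
move=> /asboolP[s ds ->]; rewrite raddf_sum big_seq rpred_sum // => z zs.
by rewrite /= liftU chainDZ // boundary_gen_degenerate //; apply: ds.
Qed.

Definition chainQ (n : nat) := {ideal_quot (@chainD n)}.

HB.instance Definition _ n := GRing.Zmodule.on (chainQ n).

Definition chainQ_proj n : chainR n -> chainQ n :=
  \pi_{ideal_quot (@chainD n)}.

Fact chainQ_proj_additive n : zmod_morphism (@chainQ_proj n).
Proof. exact: (raddfB (\pi_{ideal_quot (@chainD n)})). Qed.

HB.instance Definition _ n :=
  GRing.isZmodMorphism.Build (chainR n) (chainQ n) (@chainQ_proj n)
    (@chainQ_proj_additive n).

Lemma chainQ_projK n : cancel (fun q : chainQ n => repr q) (@chainQ_proj n).
Proof. exact: reprK. Qed.

Lemma chainQ_proj_eq n (c d : chainR n) :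
  (chainQ_proj c == chainQ_proj d) = (c - d \in @chainD n).
Proof. by rewrite Quotient.idealrBE. Qed.

Definition boundaryQ n (q : chainQ n) : chainQ n.-1 :=
  chainQ_proj (boundaryR (repr q)).

Lemma boundaryQ_proj n (c : chainR n) :
  boundaryQ (chainQ_proj c) = chainQ_proj (boundaryR c).
Proof.
apply/eqP; rewrite chainQ_proj_eq -raddfB boundaryR_chainD //.
by rewrite -chainQ_proj_eq; apply/eqP; apply: chainQ_projK.
Qed.

Lemma boundaryQ_comp n (q : chainQ n) : boundaryQ (boundaryQ q) = 0.
Proof.
by rewrite -(chainQ_projK q) !boundaryQ_proj boundaryR_comp raddf0.
Qed.

Fact boundaryQ_additive n : zmod_morphism (@boundaryQ n).
Proof.
move=> q1 q2; rewrite -(chainQ_projK q1) -(chainQ_projK q2).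
by rewrite -raddfB !boundaryQ_proj !raddfB.
Qed.

HB.instance Definition _ n :=
  GRing.isZmodMorphism.Build (chainQ n) (chainQ n.-1) (@boundaryQ n)
    (@boundaryQ_additive n).

End Chains.

(* -------------------------------------------------------------------- *)
Section Cohomology.
Variables (X : quandleType) (A : zmodType).

Definition cochain_pred n : {pred chainQ X n -> A} :=
  fun f => `[< zmod_morphism f >].

Fact cochain_pred_zmod n : zmod_closed (@cochain_pred n).
Proof.
split=> [|f g /asboolP fB /asboolP gB]; apply/asboolP => x y.
  by rewrite subrr.
transitivity (f x - f y - (g x - g y)); first by rewrite -fB -gB.
by rewrite opprD addrACA -opprD.
Qed.

HB.instance Definition _ n :=
  GRing.isZmodClosed.Build (chainQ X n -> A) (@cochain_pred n)
    (@cochain_pred_zmod n).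

(* Hom(C_n^Q(X), A) *)
Record cochain n := Cochain {
  cochain_val :> chainQ X n -> A;
  _ : cochain_val \in @cochain_pred n
}.

HB.instance Definition _ n := [isSub for @cochain_val n].
HB.instance Definition _ n := [Choice of cochain n by <:].
HB.instance Definition _ n := [SubChoice_isSubZmodule of cochain n by <:].

Lemma cochainB n (f : cochain n) : zmod_morphism f.
Proof. by apply/asboolP; exact: (valP f). Qed.

(* The map C_Q^(n-1) -> C_Q^n induced by C_n^Q -> C_(n-1)^Q; it is zero for
   n = 0, so that H^0 is the group of 0-cocycles. *)
Fact coboundary_subproof n (f : cochain n.-1) :
  (f \o @boundaryQ X n) \in @cochain_pred n.
Proof. by apply/asboolP => x y; rewrite /= raddfB cochainB. Qed.

Definition coboundary n (f : cochain n.-1) : cochain n :=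
  Cochain (coboundary_subproof f).

Fact coboundary_additive n : zmod_morphism (@coboundary n).
Proof. by move=> f g; apply: val_inj. Qed.

HB.instance Definition _ n :=
  GRing.isZmodMorphism.Build (cochain n.-1) (cochain n) (@coboundary n)
    (@coboundary_additive n).

Lemma coboundary_comp n (f : cochain n.-1) :
  @coboundary n.+1 (coboundary f) = 0.
Proof.
apply: val_inj; apply/funext => q /=.
rewrite (boundaryQ_comp q); have := cochainB f 0 0; by rewrite !subrr.
Qed.

Definition cocycle_pred n : {pred cochain n} :=
  fun f => @coboundary n.+1 f == 0.

Fact cocycle_pred_zmod n : zmod_closed (@cocycle_pred n).
Proof.
split=> [|f g]; rewrite !unfold_in; first by rewrite (raddf0 (@coboundary n.+1)).
by move=> /eqP f0 /eqP g0; rewrite (raddfB (@coboundary n.+1)) /= f0 g0 subrr.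
Qed.

HB.instance Definition _ n :=
  GRing.isZmodClosed.Build (cochain n) (@cocycle_pred n) (@cocycle_pred_zmod n).

Record cocycle n := Cocycle {
  cocycle_val :> cochain n;
  _ : cocycle_val \in @cocycle_pred n
}.

HB.instance Definition _ n := [isSub for @cocycle_val n].
HB.instance Definition _ n := [Choice of cocycle n by <:].
HB.instance Definition _ n := [SubChoice_isSubZmodule of cocycle n by <:].

Definition coboundary_pred n : {pred cocycle n} :=
  fun f => `[< exists g : cochain n.-1, val f = coboundary g >].

Fact coboundary_pred_zmod n : zmod_closed (@coboundary_pred n).
Proof.
split=> [|f g /asboolP[f' ff'] /asboolP[g' gg']]; apply/asboolP.
  by exists 0; rewrite (raddf0 (@coboundary n)) raddf0.
by exists (f' - g'); rewrite (raddfB (@coboundary n)) raddfB /= ff' gg'.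
Qed.

HB.instance Definition _ n :=
  GRing.isZmodClosed.Build (cocycle n) (@coboundary_pred n)
    (@coboundary_pred_zmod n).

Definition cohomology (n : nat) := {ideal_quot (@coboundary_pred n)}.

HB.instance Definition _ n := GRing.Zmodule.on (cohomology n).

End Cohomology.

(* -------------------------------------------------------------------- *)
Definition xi (R : idomainType) (m : nat) : laurent R :=
  \sum_(0 <= i < m) (- laurentT R) ^+ i.

(* Main.v *)
Require Import Defs.
From HB Require Import structures.
From mathcomp Require Import all_boot all_order all_algebra.
From mathcomp Require Import generic_quotient ring_quotient boolp.
From mathcomp Require Import freeg zify ring.

(** Write [T] for the class of [t] in the ring [X], [s = - T] and [q = p ^ n].
Since [xi_m] is the geometric sum of the powers of [s], it forces [s ^ m = 1],
and the values of [m] are chosen so that [m] divides [q + 1] and is invertible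
modulo [p].  Hence [s ^ (q+1) = 1]: the [q]-th power map, which is a ring
endomorphism of [X], inverts [s].

The cocycle is, with indices starting at 0,
  [f_r (x_0, ..., x_2r) =
     \prod_(i < r) (x_2i - x_(2i+1)) * (x_(2i+1) - x_(2i+2)) ^ q].
More generally, let [chi_j] be additive maps from an Alexander quandle to a
commutative ring such that [t] acts through [chi_j] as multiplication by a
constant.  Then [\prod_j chi_j (x_j - x_(j+1))] is a quandle cocycle, because
its coboundary telescopes ([chi_prod_cocycle]).

To see that [f_r] is not a coboundary, it is paired with a cycle coming from
the torus link T(2, m).  In any quandle, let [x_0, x_1, ...] be a sequence of
period [m] with [x_(k+2) = x_k * x_(k+1)]; it records the colours met along
the two strands of that closed braid.  The operator
  [(S g) w = \sum_(k < m) g (w, x_k, x_(k+1))]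
lowers the degree by 2 and commutes with the coboundary ([cobound_slant]).  In
[X] the sequence [x_k = - \sum_(j < k) s ^ j] qualifies, precisely because
[xi_m] vanishes.  As [\sum_k (s ^ k) ^ q = 0], the operator [S] multiplies by
a constant: [S f_r = C * f_(r-1)] with [C = - \sum_k x_k * s ^ (- k)], and
[(1 - s) * C = - m] is invertible.  If [f_r] were a coboundary, then so would
be [C ^ r * f_0 = C ^ r], a constant function on [X].  But coboundaries vanish
in degree 1, so that [C ^ r = 0], whereas [C] is a unit and [X] is not the
zero ring. *)

Set Implicit Arguments.
Unset Strict Implicit.
Unset Printing Implicit Defensive.

Import GRing.Theory.

Local Open Scope ring_scope.
Local Open Scope quotient_scope.

(** * Cochains as functions of sequences *)

Section SeqCochains.
Variables (X : quandleType) (A : zmodType).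
Implicit Types (g : seq X -> A) (s w : seq X) (i : nat).

(** The faces [face_del] and [face_act], for tuples of any length at once: this
avoids casts between tuple types when entries are appended. *)
Definition del_at i s := take i s ++ drop i.+1 s.

Definition act_at i s :=
  if drop i s is y :: s' then [seq qop z y | z <- take i s] ++ s' else s.

Definition cobound g s : A :=
  \sum_(1 <= i < size s) (g (del_at i s) - g (act_at i s)) *~ (-1) ^+ i.+1.

Lemma nth_del x0 i s j : (i < size s)%N ->
  nth x0 (del_at i s) j = if (j < i)%N then nth x0 s j else nth x0 s j.+1.
Proof.
move=> si; rewrite nth_cat size_takel ?(ltnW si) //; case: ltnP => ji.
  by rewrite nth_take.
by rewrite nth_drop; congr nth; lia.
Qed.

Lemma actE x0 i s : (i < size s)%N ->
  act_at i s = [seq qop z (nth x0 s i) | z <- take i s] ++ drop i.+1 s.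
Proof. by move=> si; rewrite /act_at (drop_nth x0 si). Qed.

Lemma nth_act x0 i s j : (i < size s)%N -> nth x0 (act_at i s) j =
  if (j < i)%N then qop (nth x0 s j) (nth x0 s i) else nth x0 s j.+1.
Proof.
move=> si; rewrite (actE x0 si) nth_cat size_map size_takel ?(ltnW si) //.
case: ltnP => ji; last by rewrite nth_drop; congr nth; lia.
rewrite (nth_map x0) ?nth_take // size_takel //; exact: ltnW.
Qed.

Lemma size_del i s : (i < size s)%N -> size (del_at i s) = (size s).-1.
Proof.
by move=> si; rewrite size_cat size_takel ?(ltnW si) // size_drop; lia.
Qed.

Lemma size_act i s : (i < size s)%N -> size (act_at i s) = (size s).-1.
Proof.
case: s => // x0 s si; rewrite (actE x0 si) size_cat size_map.
by rewrite size_takel ?(ltnW si) // size_drop; move: si => /=; lia.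
Qed.

Lemma del_catl i w v : (i < size w)%N -> del_at i (w ++ v) = del_at i w ++ v.
Proof.
move=> iw; rewrite /del_at takel_cat ?(ltnW iw) // drop_cat -catA.
congr (_ ++ _); case: ltnP => // wi.
have -> : i.+1 = size w by apply/eqP; rewrite eqn_leq iw.
by rewrite drop_size subnn drop0.
Qed.

Lemma act_catl i w v : (i < size w)%N -> act_at i (w ++ v) = act_at i w ++ v.
Proof.
move=> iw; rewrite /act_at takel_cat ?(ltnW iw) // drop_cat iw.
case E: (drop i w) => [|y w']; last by rewrite /= catA.
by have := congr1 size E; rewrite size_drop /=; lia.
Qed.

Lemma del_mid w y v : del_at (size w) (w ++ y :: v) = w ++ v.
Proof.
by rewrite /del_at take_size_cat // -cat_rcons drop_size_cat ?size_rcons.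
Qed.

Lemma act_mid w y v :
  act_at (size w) (w ++ y :: v) = [seq qop z y | z <- w] ++ v.
Proof. by rewrite /act_at drop_size_cat // take_size_cat. Qed.

Lemma val_face_del n (i : 'I_n.+1) (x : n.+1.-tuple X) :
  face_del i x = del_at i x :> seq X.
Proof.
have x0 := tnth x ord0.
apply: (@eq_from_nth _ x0) => [|j]; rewrite size_tuple.
  by rewrite size_del size_tuple.
move=> jn; rewrite nth_del ?size_tuple //.
rewrite -[j]/(nat_of_ord (Ordinal jn)) -tnth_nth tnth_mktuple (tnth_nth x0) /=.
by rewrite /bump; case: ltnP => ij; congr nth; lia.
Qed.

Lemma val_face_act n (i : 'I_n.+1) (x : n.+1.-tuple X) :
  face_act i x = act_at i x :> seq X.
Proof.
have x0 := tnth x ord0.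
apply: (@eq_from_nth _ x0) => [|j]; rewrite size_tuple.
  by rewrite size_act size_tuple.
move=> jn; rewrite nth_act ?size_tuple //.
rewrite -[j]/(nat_of_ord (Ordinal jn)) -tnth_nth tnth_mktuple !(tnth_nth x0) /=.
by rewrite /bump; case: ltnP => ij; [congr qop|]; congr nth; lia.
Qed.

(** * The slant product with a closed braid colouring *)

Section Slant.
Variables (x : nat -> X) (m : nat).
Hypothesis x_rec : forall k, x k.+2 = qop (x k) (x k.+1).
Hypotheses (x_m : x m = x 0) (x_mS : x m.+1 = x 1).

Definition slant g w : A := \sum_(0 <= k < m) g (w ++ [:: x k; x k.+1]).

(** The faces of [w ++ [:: a; b]] that remove an entry of [w] make up the first
summand; the others remove [a] or [b]. *)
Lemma cobound_cat2 g w a b : (0 < size w)%N ->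
  cobound g (w ++ [:: a; b]) =
  cobound (fun w' => g (w' ++ [:: a; b])) w +
  (g (w ++ [:: b]) - g ([seq qop z a | z <- w] ++ [:: b])
   - (g (w ++ [:: a]) - g ([seq qop z b | z <- w] ++ [:: qop a b])))
     *~ (-1) ^+ (size w).+1.
Proof.
move=> w0; rewrite /cobound size_cat addn2.
rewrite big_nat_recr /=; last by lia.
rewrite big_nat_recr //= -addrA; congr (_ + _).
  by apply: eq_big_nat => i /andP[_ iw]; rewrite del_catl ?act_catl.
rewrite del_mid act_mid [in X in _ + X]exprS mulN1r mulrNz.
rewrite -(cat_rcons a w [:: b]) -(size_rcons w a) del_mid act_mid.
by rewrite map_rcons !cats0 !cats1 size_rcons -mulrzBl.
Qed.

(** The faces that remove [x k] or [x k.+1] cancel in the sum over [k]: by the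
recursion, those with index [k] contribute [F k.+1 - F k] for a function [F]
that takes the same value at [0] and at [m]. *)
Lemma cobound_slant g w : (0 < size w)%N ->
  cobound (slant g) w = slant (cobound g) w.
Proof.
move=> w0; rewrite /slant.
pose F k := g (w ++ [:: x k]) + g ([seq qop z (x k) | z <- w] ++ [:: x k.+1]).
under [RHS]eq_bigr => k _.
  rewrite cobound_cat2 // -x_rec (_ : _ - _ - _ = F k.+1 - F k); first over.
  by rewrite opprB addrACA -opprD [X in _ - X]addrC.
rewrite big_split /= -mulrz_suml telescope_sumr // /F x_m x_mS subrr mul0rz.
rewrite addr0 /cobound exchange_big /=; apply: eq_bigr => i _.
by rewrite -mulrz_suml sumrB.
Qed.

End Slant.

(** * From functions of sequences to cohomology classes *)

Lemma raddf_boundary_gen k (h : {additive chainR X k -> A}) (g : seq X -> A) :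
  (forall x, h << x >> = g (tval x)) ->
  forall x : k.+1.-tuple X, h (boundary_gen x) = cobound g x.
Proof.
move=> hg x; rewrite boundary_genE raddf_sum /= /cobound size_tuple.
transitivity (\sum_(0 <= i < k.+1)
                 (g (del_at i x) - g (act_at i x)) *~ (-1) ^+ i.+1); last first.
  rewrite big_ltn // (_ : act_at 0 x = del_at 0 x) ?subrr ?mul0rz ?add0r //.
  by case: x => -[|y s] //= _; rewrite /del_at /= drop0.
rewrite big_mkord; apply: eq_bigr => i _.
rewrite -val_face_del -val_face_act -!hg -raddfB -raddfMz.
by rewrite -scaler_int intz.
Qed.

Section ClassOfFunction.
Variables (n : nat) (f : seq X -> A).
Hypothesis f_degenerate : forall x : n.+1.-tuple X, degenerate x -> f x = 0.
Hypothesis f_cocycle : forall x : n.+2.-tuple X, cobound f x = 0.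

(* [fglift] asks for values in a module over [int]. *)
Let fA (x : n.+1.-tuple X) : zmodule A := f x.
Let F (c : chainR X n.+1) : A := fglift fA c.

Let FB : zmod_morphism F.
Proof. by move=> c d; exact: (@lift_is_additive _ _ (zmodule A) fA c d). Qed.

HB.instance Definition _ := GRing.isZmodMorphism.Build (chainR X n.+1) A F FB.

Let FU k (x : n.+1.-tuple X) : F << k *g x >> = f x *~ k.
Proof. by rewrite /F liftU. Qed.

Let F_chainD c : c \in @chainD X n.+1 -> F c = 0.
Proof.
move=> /asboolP[s ds ->]; rewrite raddf_sum big_seq big1 // => z /ds dz.
by apply: (etrans (FU _ _)); rewrite f_degenerate // mul0rz.
Qed.

Let F_boundary (c : chainR X n.+2) : F (boundaryR c) = 0.
Proof.
rewrite -[c]freeg_sumE !raddf_sum; apply: big1 => x _.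
transitivity (F (@boundaryR X n.+2 << coeff x c *g x >>)); first by [].
rewrite /= liftU -[coeff x c]intz scaler_int raddfMz.
by rewrite (raddf_boundary_gen (g := f)) ?f_cocycle ?mul0rz.
Qed.

Let fQ (q : chainQ X n.+1) : A := F (repr q).

Let fQ_proj c : fQ (chainQ_proj c) = F c.
Proof.
apply/eqP; rewrite -subr_eq0 /fQ -FB F_chainD //.
by rewrite -chainQ_proj_eq; apply/eqP; apply: chainQ_projK.
Qed.

Let fQ_cochain : fQ \in @cochain_pred X A n.+1.
Proof.
apply/asboolP => q1 q2; rewrite -(chainQ_projK q1) -(chainQ_projK q2).
by rewrite -raddfB !fQ_proj FB.
Qed.

Let fC : cochain X A n.+1 := Cochain fQ_cochain.

Let fC_cocycle : fC \in @cocycle_pred X A n.+1.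
Proof.
apply/eqP/val_inj/funext => q /=.
by rewrite -(chainQ_projK q) boundaryQ_proj fQ_proj F_boundary.
Qed.

(** Primitives are sought among arbitrary functions, whatever their values on
degenerate tuples: such functions are stable under [slant], which is how they
are ruled out below. *)
Lemma cohomology_neq0 :
  (forall g : seq X -> A, exists x : n.+1.-tuple X, f x != cobound g x) ->
  exists h : cohomology X A n.+1, h != 0.
Proof.
move=> f_not_cob.
exists (\pi_{ideal_quot (@coboundary_pred X A n.+1)} (Cocycle fC_cocycle)).
rewrite -[X in _ != X](raddf0 (\pi_{ideal_quot (@coboundary_pred X A n.+1)})).
rewrite -Quotient.idealrBE subr0; apply/asboolP => -[/= g fg].
pose gs s :=
  if insub s is Some y then g (chainQ_proj << (y : n.-tuple X) >>) else 0.
have [x /eqP[]] := f_not_cob gs.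
have gB : zmod_morphism (fun c => g (chainQ_proj c)).
  by move=> c d; rewrite raddfB cochainB.
pose gA := HB.pack_for {additive chainR X n -> A} (fun c => g (chainQ_proj c))
  (GRing.isZmodMorphism.Build _ _ _ gB).
rewrite -(raddf_boundary_gen (h := gA)) /= => [|y]; last by rewrite /gs valK.
rewrite -[f x]mulr1z -FU -fQ_proj -[fQ _]/(fC _) fg /=.
by rewrite boundaryQ_proj /= liftU scale1r.
Qed.

End ClassOfFunction.

End SeqCochains.

(** * Product cocycles of Alexander quandles *)

Section Cocycle.
Variables (R : idomainType) (M : lmodType (laurent R)) (B : comPzRingType).
Variables (chi : nat -> M -> B) (tau : nat -> B).
Hypothesis chiB : forall j, zmod_morphism (chi j).
Hypothesis chiT : forall j u, chi j (laurentT R *: u) = tau j * chi j u.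

Definition chi_prod (s : seq (alexander M)) : B :=
  \prod_(0 <= j < (size s).-1) chi j ((nth 0 s j : M) - nth 0 s j.+1).

(** Put [U_j = x_j - x_(j+1)].  Removing [x_(k+1)] replaces [U_k] and [U_(k+1)]
by their sum; acting by [x_(k+1)] moreover multiplies [U_0, ..., U_k] by [t].
With [P k] the product of the [chi_j U_j] for [j < k], [Q k] that of the
[chi_j U_(j+1)] for [k <= j], and [c k] that of the [tau_j] for [j < k], the two
faces differ by [E k + E k.+1], where [E k = (1 - c k) * P k * Q k].  Removing
the last entry gives a single [E], which is what the alternating sum leaves
over, and [E 0 = 0] because [c 0 = 1]. *)
Lemma chi_prod_cocycle (s : seq (alexander M)) : cobound chi_prod s = 0.
Proof.
have chi0 j : chi j 0 = 0 by rewrite -(subrr 0) chiB subrr.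
have chiD j u v : chi j (u + v) = chi j u + chi j v.
  by rewrite -[v in LHS]opprK chiB -[- v]sub0r chiB chi0 sub0r opprK.
case: (ltnP 1 (size s)) => [s1|s1]; last by rewrite /cobound big_geq.
set N := (size s).-2; have sN : size s = N.+2 by rewrite /N; lia.
pose U j : M := nth 0 s j - nth 0 s j.+1.
pose P k := \prod_(0 <= j < k) chi j (U j).
pose c k := \prod_(0 <= j < k) tau j.
pose Q k := \prod_(k <= j < N) chi j (U j.+1).
pose E k := (1 - c k) * P k * Q k.
have PS k : P k.+1 = P k * chi k (U k) by rewrite /P big_nat_recr.
have cS k : c k.+1 = c k * tau k by rewrite /c big_nat_recr.
have QS k : (k < N)%N -> Q k = chi k (U k.+1) * Q k.+1.
  by move=> kN; rewrite /Q big_ltn.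
have split_prod G k : (k <= N)%N -> \prod_(0 <= j < N) G j =
    \prod_(0 <= j < k) G j *
      if k == N then 1 else G k * \prod_(k.+1 <= j < N) G j :> B.
  move=> kN; rewrite (big_cat_nat _ kN) //=; congr (_ * _).
  case: eqP => [->|/eqP kN']; first by rewrite big_geq.
  by rewrite big_ltn //; lia.
have nthD k j : (k <= N)%N -> nth (0 : M) (del_at k.+1 s) j =
    if (j <= k)%N then nth 0 s j else nth 0 s j.+1.
  by move=> kN; apply: (@nth_del (alexander M)); rewrite sN !ltnS.
have nthA k j : (k <= N)%N -> nth (0 : M) (act_at k.+1 s) j =
    if (j <= k)%N then alexander_op (nth 0 s j) (nth 0 s k.+1)
    else nth 0 s j.+1.
  by move=> kN; apply: (@nth_act (alexander M)); rewrite sN !ltnS.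
have del_prod k : (k <= N)%N -> chi_prod (del_at k.+1 s) = P k *
    if k == N then 1 else (chi k (U k) + chi k (U k.+1)) * Q k.+1.
  move=> kN; rewrite /chi_prod size_del sN ?ltnS // (split_prod _ k) //=.
  congr (_ * _).
    by apply: eq_big_nat => j /andP[_ jk]; rewrite !nthD // jk (ltnW jk).
  case: eqP => // _; congr (_ * _).
    by rewrite !nthD // leqnn ltnn -chiD addrA subrK.
  apply: eq_big_nat => j /andP[kj _].
  by rewrite !nthD // (ltn_geF kj) (ltn_geF (leqW kj)).
have act_prod k : (k <= N)%N -> chi_prod (act_at k.+1 s) = c k * P k *
    if k == N then 1 else (tau k * chi k (U k) + chi k (U k.+1)) * Q k.+1.
  move=> kN; rewrite /chi_prod size_act sN ?ltnS // (split_prod _ k) //=.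
  congr (_ * _).
    rewrite -big_split /=; apply: eq_big_nat => j /andP[_ jk].
    rewrite !nthA // jk (ltnW jk) -chiT /alexander_op.
    by rewrite opprD addrACA subrr addr0 scalerBr.
  case: eqP => // _; congr (_ * _).
    rewrite !nthA // leqnn ltnn -chiT -chiD /alexander_op /U.
    rewrite scalerBl scale1r scalerBr.
    by congr (chi _ _); rewrite addrA addrA addrAC.
  apply: eq_big_nat => j /andP[kj _].
  by rewrite !nthA // (ltn_geF kj) (ltn_geF (leqW kj)).
rewrite /cobound sN big_add1 big_nat_recr //=.
rewrite del_prod // act_prod // eqxx !mulr1.
pose V k := E k *~ (-1) ^+ k.+1.
rewrite (eq_big_nat _ _ (F2 := fun k => V k.+1 - V k)).
  rewrite telescope_sumr // (_ : V 0 = 0) ?subr0; last first.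
    by rewrite /V /E /c big_geq // subrr !mul0r mul0rz.
  rewrite /V [X in _ + _ *~ X]exprS mulN1r mulrNz.
  by rewrite /E /Q big_geq // mulr1 mulrBl mul1r subrr.
move=> k /andP[_ kN]; rewrite del_prod 1?ltnW // act_prod 1?ltnW // ltn_eqF //.
have -> : V k.+1 - V k = (E k.+1 + E k) *~ (-1) ^+ k.+2.
  by rewrite /V (exprS _ k.+1) mulN1r !mulrNz mulrzDl opprD.
congr (_ *~ _); rewrite /E PS cS (QS _ kN); ring.
Qed.

Lemma chi_prod_degenerate n (x : n.-tuple (alexander M)) :
  degenerate x -> chi_prod x = 0.
Proof.
move=> [i [j [ji xij]]]; have jn := ltn_ord j.
rewrite /chi_prod size_tuple (big_cat_nat _ (n := i)) //=; last by lia.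
rewrite [X in _ * X]big_ltn; last by lia.
rewrite -ji -!(tnth_nth (0 : M)) xij subrr.
have := chiB i 0 0; rewrite !subrr => ->; ring.
Qed.

Lemma chi_prod_cat2 (w : seq (alexander M)) a b : (0 < size w)%N ->
  chi_prod (w ++ [:: a; b]) = chi_prod w *
  (chi (size w).-1 (last (0 : M) w - a) * chi (size w) ((a : M) - b)).
Proof.
case/lastP: w => // w y _; rewrite last_rcons.
rewrite /chi_prod size_cat !size_rcons addn2 /=.
rewrite !big_nat_recr //= -mulrA -cats1 -catA /= !nth_cat !ltnNge leqnn !subnn.
rewrite leqnSn subSnn -addn2 leq_addr addKn; congr (_ * _).
apply: eq_big_nat => j /andP[_ jw]; rewrite !nth_cat jw; case: ltnP => // wj.
by rewrite (_ : j.+1 = size w) ?subnn //; apply/eqP; rewrite eqn_leq jw.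
Qed.

End Cocycle.

(** * The ring structure of a principal quotient *)

Section QuotientRing.
Variables (A : comNzRingType) (a : A).

Definition quot_by_mul (x y : quot_by a) : quot_by a :=
  quot_by_scale (repr x) y.

Let mul_proj u v :
  quot_by_mul (quot_by_proj a u) (quot_by_proj a v) = quot_by_proj a (u * v).
Proof.
rewrite /quot_by_mul quot_by_scale_proj [LHS](congr1 _ (mulrC _ _)).
rewrite -[LHS]quot_by_scale_proj (quot_by_projK (quot_by_proj a u)).
by rewrite quot_by_scale_proj mulrC.
Qed.

Fact quot_by_mulA : associative quot_by_mul.
Proof.
move=> x y z; rewrite -(quot_by_projK x) -(quot_by_projK y) -(quot_by_projK z).
by rewrite !mul_proj mulrA.
Qed.

Fact quot_by_mulC : commutative quot_by_mul.
Proof.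
move=> x y; rewrite -(quot_by_projK x) -(quot_by_projK y).
by rewrite !mul_proj mulrC.
Qed.

Fact quot_by_mul1 : left_id (quot_by_proj a 1) quot_by_mul.
Proof. by move=> x; rewrite -(quot_by_projK x) mul_proj mul1r. Qed.

Fact quot_by_mulDl : left_distributive quot_by_mul +%R.
Proof.
move=> x y z; rewrite -(quot_by_projK x) -(quot_by_projK y) -(quot_by_projK z).
by rewrite -quot_by_projD !mul_proj mulrDl quot_by_projD.
Qed.

HB.instance Definition _ :=
  GRing.Zmodule_isComPzRing.Build (quot_by a)
    quot_by_mulA quot_by_mulC quot_by_mul1 quot_by_mulDl.

HB.instance Definition _ :=
  GRing.isZmodMorphism.Build A (quot_by a) (@quot_by_proj A a)
    (@quot_by_projB A a).

Fact quot_by_proj_monoid : monoid_morphism (@quot_by_proj A a).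
Proof. by split=> // u v; rewrite -mul_proj. Qed.

HB.instance Definition _ :=
  GRing.isMonoidMorphism.Build A (quot_by a) (@quot_by_proj A a)
    quot_by_proj_monoid.

Lemma quot_by_scaleE (c : A) (x : quot_by a) : c *: x = quot_by_proj a c * x.
Proof.
by rewrite -(quot_by_projK x) -rmorphM; apply: quot_by_scale_proj.
Qed.

End QuotientRing.

(** * Non-triviality by pairing with a torus link *)

Lemma expr1_of_geom_sum0 (B : pzRingType) (z : B) k :
  \sum_(0 <= i < k) z ^+ i = 0 -> z ^+ k = 1.
Proof.
move=> z0; apply/eqP; rewrite -subr_eq0 subrX1.
by rewrite -[\sum_(i < k) _](big_mkord xpredT (GRing.exp z)) z0 mulr0.
Qed.

Section Torus.
Variables (R : idomainType) (a : laurent R) (q m : nat).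
Let B : comPzRingType := quot_by a.
Let s : B := - quot_by_proj a (laurentT R).
(* The [q]-th power map plays the part of the involution inverting [s]; it is
   multiplicative for free, so only additivity has to be assumed. *)
Hypothesis frobB : zmod_morphism (fun x : B => x ^+ q).
Hypothesis s_sum : \sum_(0 <= k < m) s ^+ k = 0.
Hypothesis s_q : s ^+ q.+1 = 1.
Variable u : B.
Hypothesis u_m : u * m%:R = 1.
Hypothesis B_nontrivial : 1 != 0 :> B.

Let X := alexander (quot_by a).

Let chi j (x : quot_by a) : quot_by a := if odd j then x ^+ q else x.
Let tau j : B := if odd j then (- s) ^+ q else - s.

Let chiB j : zmod_morphism (chi j).
Proof. by rewrite /chi; case: odd. Qed.

Let chiT j x : chi j (laurentT R *: x) = tau j * chi j x.
Proof.
rewrite /chi /tau quot_by_scaleE -[quot_by_proj _ _]opprK -/s.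
by case: odd => //; rewrite exprMn.
Qed.

Let s_m : s ^+ m = 1.
Proof. exact: expr1_of_geom_sum0. Qed.

(* The differences of consecutive terms are the powers of [s], as they must be
   in any solution of the recursion [torus_rec] up to a common factor. *)
Let torus k : X := - \sum_(0 <= j < k) s ^+ j : B.

Let torusB k : (torus k : B) - torus k.+1 = s ^+ k.
Proof. by rewrite /torus opprK big_nat_recr //= addKr. Qed.

Let torus_rec k : torus k.+2 = qop (torus k) (torus k.+1).
Proof.
rewrite [RHS]/(alexander_op _ _) /alexander_op scalerBl scale1r !quot_by_scaleE.
rewrite -[quot_by_proj _ _]opprK -/s.
have torusS i : torus i.+1 = (torus i : B) - s ^+ i.
  by rewrite -torusB opprB addrC subrK.
rewrite !torusS exprS; ring.
Qed.

Let torus_m : torus m = torus 0.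
Proof. by rewrite /torus s_sum big_geq. Qed.

Let torus_mS : torus m.+1 = torus 1.
Proof. by rewrite /torus big_nat_recr //= s_sum s_m add0r big_nat1. Qed.

Let C : B := - \sum_(0 <= k < m) (torus k : B) * (s ^+ k) ^+ q.

Let frob_s_sum : \sum_(0 <= k < m) (s ^+ k) ^+ q = 0.
Proof.
have frob0 : (0 : B) ^+ q = 0 by rewrite -[in LHS](subrr 0) frobB subrr.
have frobD : {morph (fun x : B => x ^+ q) : x y / x + y}.
  move=> x y; rewrite -[y in LHS]opprK frobB.
  by rewrite -[- y]sub0r frobB frob0 sub0r opprK.
by rewrite -(big_morph _ frobD frob0) s_sum.
Qed.

(* Multiplied by [1 - s], the geometric sum [- torus k] becomes [1 - s ^ k]; then
   [s ^ k * (s ^ k) ^ q = 1] and the other terms add up to [0]. *)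
Let C_unit : (1 - s) * C = - m%:R.
Proof.
rewrite /C mulrN mulr_sumr; congr (- _).
rewrite (eq_bigr (fun k => 1 - (s ^+ k) ^+ q)) => [|k _].
  by rewrite sumrB frob_s_sum subr0 sumr_const_nat subn0.
have -> : (1 - s) * ((torus k : B) * s ^+ k ^+ q) = (s ^+ k - 1) * s ^+ k ^+ q.
  rewrite subrX1 -(big_mkord xpredT (GRing.exp s)) /torus; ring.
by rewrite mulrBl mul1r -exprS (exprAC _ k q.+1) s_q expr1n.
Qed.

(* The last entry [y] of [w] enters through [y - torus k]; its contribution
   [y * \sum_k (s ^ k) ^ q] vanishes and leaves a constant factor. *)
Let slant_chi_prod (w : seq X) : odd (size w) ->
  slant torus m (chi_prod chi : seq X -> B) w = C * chi_prod chi w.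
Proof.
case: w => // x w wo; rewrite /slant.
under eq_bigr => k _ do
  rewrite chi_prod_cat2 // /chi wo (negbTE (_ : ~~ odd (size (x :: w)).-1)) //
          torusB mulrBl.
rewrite -mulr_sumr sumrB -mulr_sumr frob_s_sum mulr0 sub0r; exact: mulrC.
Qed.

(* The factor [c] accumulates the powers of [C] along the induction. *)
Let no_primitive r c (g : seq X -> B) :
  (forall w : seq X, size w = r.*2.+1 -> c * chi_prod chi w = cobound g w) ->
  c * C ^+ r = 0.
Proof.
elim: r c g => [|r IHr] c g cg.
  have := cg [:: (0 : quot_by a)] erefl.
  by rewrite /chi_prod /cobound !big_geq // expr0.
rewrite exprS mulrA; apply: (IHr _ (slant torus m g)) => w sw.
rewrite (cobound_slant torus_rec) // ?sw //.
rewrite -mulrA -slant_chi_prod ?sw /= ?odd_double // /slant mulr_sumr.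
by apply: eq_bigr => k _; rewrite -cg // size_cat sw addn2.
Qed.

(** Slanting a primitive of [chi_prod chi] [r] times would give [C ^ r = 0],
although [- u * (1 - s)] is an inverse of [C]. *)
Lemma alexander_cohomology_neq0 r :
  exists h : cohomology X (quot_by a) (2 * r + 1), h != 0.
Proof.
rewrite addn1 mul2n.
apply: (@cohomology_neq0 X (quot_by a) r.*2 (chi_prod chi)) => [x|x|g].
- exact: (chi_prod_degenerate chiB).
- exact: (chi_prod_cocycle chiB chiT).
apply: contrapT => none.
have /no_primitive : forall w : seq X, size w = r.*2.+1 ->
    1 * chi_prod chi w = cobound (g : seq X -> B) w.
  move=> w /eqP sw; rewrite mul1r; apply: contrapT => ne; apply: none.
  by exists (Tuple sw); apply/eqP.
rewrite mul1r => Cr0.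
have : ((1 - s) * C * - u) ^+ r = 1 by rewrite C_unit mulrNN mulrC u_m expr1n.
rewrite mulrAC exprMn Cr0 mulr0 => /eqP.
by rewrite eq_sym (negbTE B_nontrivial).
Qed.

End Torus.

(** * Arithmetic of the coefficient ring *)

Section PrimeField.
Variable p : nat.
Hypothesis p_prime : prime p.

Lemma pchar_laurent_Fp : p \in [pchar (laurent 'F_p)].
Proof.
rewrite inE p_prime; apply/eqP/val_inj; rewrite rmorph_nat rmorph0.
pose iota := @FracField.tofrac {poly 'F_p} \o polyC.
exact: pcharf0 (rmorph_pchar iota (pchar_Fp p_prime)).
Qed.

Lemma Frobenius_quot_by (a : laurent 'F_p) n :
  zmod_morphism (fun x : quot_by a => x ^+ (p ^ n)).
Proof.
have pn : [pchar (laurent 'F_p)].-nat (p ^ n)%N.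
  by rewrite pnatX (pnatE _ p_prime) pchar_laurent_Fp.
move=> x y; rewrite -(quot_by_projK x) -(quot_by_projK y) -raddfB -!rmorphXn.
by rewrite exprDn_pchar // exprNn_pchar // raddfB.
Qed.

End PrimeField.

(** If [xi_k] divided [1] among the Laurent polynomials, it would divide a power
of ['X] in [R[X]]; but it is coprime to ['X], its constant coefficient being
[1], and its degree [k - 1] is positive. *)
Lemma quot_by_xi_nontrivial (R : fieldType) k : (1 < k)%N ->
  1 != 0 :> quot_by (xi R k).
Proof.
move=> k1; pose proj := @quot_by_proj _ (xi R k).
rewrite -(rmorph1 proj) -(raddf0 proj) quot_by_proj_eq subr0.
apply/asboolP => -[c].
pose f : {poly R} := \sum_(0 <= i < k) (- 'X) ^+ i.
have xiE : val (xi R k) = FracField.tofrac f.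
  rewrite /xi /f !rmorph_sum /=; apply: eq_bigr => i _.
  rewrite rmorphXn raddfN.
  by transitivity (val ((- laurentT R) ^+ i)); rewrite // rmorphXn raddfN.
move/(congr1 val); rewrite rmorph1 rmorphM /= xiE.
have /asboolP[P [l ->]] := valP c; rewrite mulrAC -rmorphXn -rmorphM.
move/(congr1 (fun z => z * FracField.tofrac ('X ^+ l))).
rewrite mul1r divfK ?tofrac_eq0 ?expf_neq0 ?polyX_eq0 // => /eqP.
rewrite tofrac_eq => /eqP XPf.
have f_poly : f = \poly_(i < k) (-1) ^+ i.
  rewrite poly_def /f big_mkord; apply: eq_bigr => i _.
  by rewrite -scaleN1r exprZn.
have fX : coprimep f 'X.
  rewrite coprimepX /root horner_coef0 f_poly coef_poly ltnW //.
  by rewrite expr0 oner_eq0.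
have : size f == 1%N.
  rewrite -coprimepp (@coprimep_dvdl _ ('X ^+ l)) ?coprimep_expr //.
  by rewrite XPf dvdp_mull.
by rewrite f_poly size_poly_eq ?signr_eq0 // gtn_eqF.
Qed.

Theorem theorem4p4 (p n m r : nat) :
  (0 < n)%N -> (1 < r)%N ->
  (p = 2%N /\ m = (2 ^ n + 1)%N) \/
  ([/\ prime p, odd p & m = ((p ^ n + 1) %/ 2)%N]) ->
  let X := quot_by (xi 'F_p m) in
  exists h : cohomology (alexander X) X (2 * r + 1), h != 0.
Proof.
move=> n0 _ pm X.
(* Both cases say that [m] divides [p ^ n + 1]; the cofactor [e] is then an
   inverse of [m] modulo [p]. *)
have [p_prime [e eE]] : prime p /\ exists e, (e * m)%N = (p ^ n).+1.
  case: pm => [[-> ->]|[pp po ->]]; split=> //.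
    by exists 1%N; rewrite mul1n addn1.
  by exists 2%N; rewrite mulnC divnK ?addn1 // dvdn2 /= oddX po orbT.
have m1 : (1 < m)%N.
  case: pm => [[_ ->]|[pp po ->]]; first by rewrite addn1 ltnS expn_gt0.
  have p3 : (3 <= p)%N by case: p pp po {eE p_prime X} => [|[|[]]].
  have pn : (p <= p ^ n)%N by rewrite -{1}(expn1 p) leq_exp2l // ltnW.
  by rewrite leq_divRL //; lia.
set s : X := - quot_by_proj (xi 'F_p m) (laurentT 'F_p).
have s_sum : \sum_(0 <= k < m) s ^+ k = 0.
  transitivity (quot_by_proj (xi 'F_p m) (xi 'F_p m)).
    rewrite [X in _ = quot_by_proj _ X]/xi rmorph_sum; apply: eq_bigr => k _.
    by rewrite rmorphXn raddfN.
  rewrite -[RHS](raddf0 (@quot_by_proj _ (xi 'F_p m))); apply/eqP.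
  by rewrite quot_by_proj_eq subr0; apply/asboolP; exists 1; rewrite mul1r.
have s_m : s ^+ m = 1 by apply: expr1_of_geom_sum0.
have pX : (p%:R : X) = 0.
  rewrite -(rmorph_nat (@quot_by_proj _ (xi 'F_p m))).
  by rewrite (pcharf0 (pchar_laurent_Fp p_prime)) raddf0.
apply: (@alexander_cohomology_neq0 _ _ (p ^ n) m _ _ _ e%:R) => //.
- exact: Frobenius_quot_by.
- by rewrite -eE mulnC exprM s_m expr1n.
- by rewrite -natrM eE -(prednK n0) expnS -natr1 natrM pX mul0r add0r.
- exact: quot_by_xi_nontrivial.
Qed.
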